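(* Let $q=q_1\cdots q_k$ be a pattern of length $k$ with $q_1=1$, and let $q'=1\,(q_1+1)(q_2+1)\cdots(q_k+1)$ be the pattern of length $k+1$ obtained by adding 1 to each entry of $q$ and prepending the entry 1. Then $L(q')=1+L(q)+2\sqrt{L(q)}$.
   Context: A permutation $p=p_1\cdots p_n$ of $[n]$ contains a pattern $q$ (a permutation of $[k]$) if there are indices $i_1<\dots<i_k$ with $p_{i_a}<p_{i_b}$ iff $q_a<q_b$; otherwise $p$ avoids $q$. $S_n(q)$ is the number of permutations of length $n$ avoiding $q$, and $L(q)=\lim_{n\to\infty}\sqrt[n]{S_n(q)}$ (this limit is known to exist for every pattern $q$). *)

(* Defs.v *)
From mathcomp Require Import all_boot all_order all_algebra all_fingroup.
From mathcomp Require Import all_classical all_reals all_analysis.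
Import numFieldNormedType.Exports.

Set Implicit Arguments.
Unset Strict Implicit.
Unset Printing Implicit Defensive.

Local Open Scope nat_scope.

(* A permutation p_1 ... p_n of [n] is an element of 'S_n, with positions and
   entries shifted down by one: p_(i+1) - 1 is p i. *)
Definition contains (n k : nat) (p : 'S_n) (q : 'S_k) : bool :=
  [exists f : {ffun 'I_k -> 'I_n},
    [forall a : 'I_k, forall b : 'I_k, (a < b) ==> (f a < f b)] &&
    [forall a : 'I_k, forall b : 'I_k, (p (f a) < p (f b)) == (q a < q b)]].

Definition avoids (n k : nat) (p : 'S_n) (q : 'S_k) : bool := ~~ contains p q.

Definition num_avoiders (k : nat) (q : 'S_k) (n : nat) : nat :=
  #|[set p : 'S_n | avoids p q]|.

(* L(q); the term n = 0 of the sequence is a junk value. *)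
Definition growth_limit (R : realType) (k : nat) (q : 'S_k) : R :=
  limn (fun n : nat => ((num_avoiders q n)%:R : R) `^ (n%:R^-1))%R.

(* [lift_perm ord0 ord0 q] sends 0 to 0 and i+1 to (q i)+1. *)
Definition prepend_min (k : nat) (q : 'S_k) : 'S_k.+1 :=
  lift_perm ord0 ord0 q.

(* Main.v *)
Require Import Defs.
From mathcomp Require Import all_boot all_order all_algebra all_fingroup.
From mathcomp Require Import all_classical all_reals all_analysis.
From mathcomp Require Import zify ring lra fintype finset.
Import numFieldNormedType.Exports.
Import Order.TTheory GRing.Theory Num.Theory.

(** Since [q] starts with its minimum, a permutation avoids [q' = prepend_min q]
    iff its entries other than the left-to-right minima avoid [q]. A permutation
    of length [n] with [c] marked decreasing entries whose other entries avoid [q]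
    amounts to the positions and the values of the marked entries and a
    [q]-avoider of length [n - c], so there are [T n c = C(n,c)^2 S_(n-c)(q)] of
    them. Hence [S_n(q') <= \sum_c T n c]. Conversely, marked permutations of
    length [N] with [c] marked entries each can be chained along a staircase, each
    one lending its marked values to the marked positions of the preceding one:
    this gives [T N c ^ s <= S_(c+1+sN)(q')] for all [s].

    Skew sums make [S_n] supermultiplicative, so by Fekete's lemma [L(q)] is a
    supremum, which is finite by the theorem of Marcus and Tardos (with Klazar's
    reduction). Then [S_n(q') <= \sum_c C(n,c)^2 L^(n-c) <= (1 + sqrt L)^(2n)],
    while the lower bound gives [T n c <= L(q')^n]; comparing square roots with
    the binomial expansion of [(1 + sqrt x)^n], [x] close to [L], yields
    [1 + sqrt L <= sqrt L(q')]. *)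

Set Implicit Arguments.
Unset Strict Implicit.
Unset Printing Implicit Defensive.

Local Open Scope nat_scope.

(** * Order-preserving relabellings *)

(** With a relation instead of a map, the image need only be described by its order properties,
    existence and uniqueness being proved separately. *)
Lemma card_le_rel (T1 T2 : finType) (A : {set T1}) (B : {set T2})
    (rel : T1 -> T2 -> Prop) :
  (forall a, a \in A -> exists2 b, b \in B & rel a b) ->
  (forall a a' b, a \in A -> a' \in A -> rel a b -> rel a' b -> a = a') ->
  #|A| <= #|B|.
Proof.
move=> tot inj.
pose f a := [pick b | (b \in B) && `[< rel a b >]].
have fP a : a \in A -> exists b, [/\ f a = Some b, b \in B & rel a b].
  move=> aA; rewrite /f; case: pickP => [b /andP[bB /asboolP rab]|none].
    by exists b.
  have [b bB rab] := tot a aA.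
  by have := none b; rewrite bB /=; move/asboolP: rab => ->.
have finj : {in A &, injective f}.
  move=> a a' aA a'A eqf; have [b [fa _ rab]] := fP a aA.
  have [b' [fa' _ rab']] := fP a' a'A.
  move: rab' (rab); rewrite fa fa' in eqf; case: eqf => <- rab' {}rab.
  exact: inj rab rab'.
have some_inj : injective (@Some T2) by move=> b b' [].
rewrite -(card_in_imset finj) -(card_imset B some_inj).
apply: subset_leq_card; apply/subsetP => _ /imsetP[a aA ->].
by have [b [-> bB _]] := fP a aA; apply/imsetP; exists b.
Qed.

(** Each [x] receives the entry of sorted [V] whose index is the rank of [x], the number of members
    of [A] with a smaller [g]. *)
Lemma fit_order (T : finType) (A : {set T}) (V : seq nat) (g : T -> nat) :
  {in A &, injective g} -> uniq V -> #|A| = size V ->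
  exists2 h : T -> nat, {in A, forall x, h x \in V}
    & {in A &, forall x y, (h x < h y) = (g x < g y)}.
Proof.
move=> ginj Vuniq cardA.
pose rk x := #|[set y in A | g y < g x]|.
have rk_lt x : x \in A -> rk x < size V.
  move=> xA; rewrite -cardA /rk; apply: proper_card; apply/properP; split.
    by apply/subsetP => y; rewrite inE => /andP[].
  by exists x => //; rewrite inE ltnn andbF.
have rk_mono x y : x \in A -> g x < g y -> rk x < rk y.
  move=> xA ltxy; apply: proper_card; apply/properP; split.
    by apply/subsetP => z; rewrite !inE => /andP[-> /ltn_trans]; apply.
  by exists x; rewrite inE xA ?ltnn.
pose V' := sort leq V.
have sV' : sorted ltn V'.
  by rewrite ltn_sorted_uniq_leq sort_uniq Vuniq sort_sorted //; exact: leq_total.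
have szV' : size V' = size V by rewrite size_sort.
have h_mono x y : x \in A -> y \in A -> g x < g y ->
    nth 0 V' (rk x) < nth 0 V' (rk y).
  move=> xA yA ltxy; apply: (sorted_ltn_nth ltn_trans) => //.
  - by rewrite inE szV' rk_lt.
  - by rewrite inE szV' rk_lt.
  - exact: rk_mono.
exists (fun x => nth 0 V' (rk x)) => [x xA|x y xA yA].
  by rewrite -(mem_sort leq) mem_nth // szV' rk_lt.
case: (ltngtP (g x) (g y)) => [lt|gt|eq].
- exact: h_mono.
- by apply/negbTE; rewrite -leqNgt ltnW // h_mono.
- by rewrite (ginj x y) ?ltnn.
Qed.

(** Strong induction on [h1 x]: if the two values at [x] differ, the smaller one is taken by the
    other function at some [y] lower in the common order, where both functions already agree. *)
Lemma eq_in_order (T : finType) (A : {set T}) (h1 h2 : T -> nat) :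
  {in A &, forall x y, (h1 x < h1 y) = (h2 x < h2 y)} ->
  {in A, forall x, exists2 y, y \in A & h1 x = h2 y} ->
  {in A, forall x, exists2 y, y \in A & h2 x = h1 y} ->
  {in A, h1 =1 h2}.
Proof.
move=> ord sub12 sub21 x.
have [n] := ubnP (h1 x); elim: n x => // n IHn x /ltnSE le_x xA.
case: (ltngtP (h1 x) (h2 x)) => // [lt|gt].
- have [y yA h1x] := sub12 x xA.
  have lt1 : h1 y < h1 x by rewrite ord // -h1x.
  by have := IHn y (leq_trans lt1 le_x) yA; lia.
- have [y yA h2x] := sub21 x xA.
  have lt1 : h1 y < h1 x by rewrite -h2x.
  have := IHn y (leq_trans lt1 le_x) yA.
  by move: lt1; rewrite ord //; lia.
Qed.

Lemma perm_eq_order (n : nat) (p1 p2 : 'S_n) :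
  (forall i j, (p1 i < p1 j) = (p2 i < p2 j)) -> p1 = p2.
Proof.
move=> ord; apply/permP => i; apply: val_inj.
apply: (@eq_in_order _ [set: 'I_n] (fun i => p1 i) (fun i => p2 i)) => //.
- by move=> x _; exists (p2^-1%g (p1 x)); rewrite ?permKV.
- by move=> x _; exists (p1^-1%g (p2 x)); rewrite ?permKV.
Qed.

Lemma perm_of_nat (n : nat) (h : 'I_n -> nat) :
  (forall i, h i < n) -> injective h -> exists s : 'S_n, forall i, s i = h i :> nat.
Proof.
move=> hlt hinj.
have inj : injective (fun i => Ordinal (hlt i)).
  by move=> i j /(congr1 val) /=; exact: hinj.
by exists (perm inj) => i; rewrite permE.
Qed.

Lemma perm_of_order (n : nat) (g : 'I_n -> nat) :
  injective g -> exists s : 'S_n, forall i j, (s i < s j) = (g i < g j).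
Proof.
move=> ginj.
have [| | |h hV hord] := @fit_order _ [set: 'I_n] (iota 0 n) g.
- by move=> i j _ _; exact: ginj.
- exact: iota_uniq.
- by rewrite cardsT card_ord size_iota.
have [i|i j eqh|s sE] := @perm_of_nat n h.
- by have := hV i (in_setT _); rewrite mem_iota.
- apply: ginj; have := hord i j (in_setT _) (in_setT _).
  have := hord j i (in_setT _) (in_setT _); rewrite eqh ltnn.
  by case: ltngtP.
- by exists s => i j; rewrite !sE hord ?in_setT.
Qed.

(** The set [D] lets one notion cover occurrences in a whole permutation and among its unmarked
    entries, without standardising the latter. *)
Definition occurs (n k : nat) (p : 'I_n -> nat) (D : {set 'I_n}) (q : 'S_k) : Prop :=
  exists f : 'I_k -> 'I_n,
    [/\ forall a, f a \in D, forall a b : 'I_k, a < b -> f a < f b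
      & forall a b : 'I_k, (p (f a) < p (f b)) = (q a < q b)].

Lemma containsP (n k : nat) (p : 'S_n) (q : 'S_k) :
  reflect (occurs (fun i => p i) [set: 'I_n] q) (contains p q).
Proof.
apply: (iffP existsP) => [[f /andP[/forallP fi /forallP fo]]|[f [_ fi fo]]].
  exists f; split=> [a|a b|a b]; first exact: in_setT.
    by move/forallP/(_ b)/implyP: (fi a); apply.
  by move/forallP/(_ b)/eqP: (fo a).
exists (finfun f); apply/andP; split; apply/forallP => a; apply/forallP => b.
  by rewrite !ffunE; apply/implyP; exact: fi.
by rewrite !ffunE fo.
Qed.

Lemma avoidsP (n k : nat) (p : 'S_n) (q : 'S_k) :
  reflect (~ occurs (fun i => p i) [set: 'I_n] q) (avoids p q).
Proof. by apply: (iffP negP) => H /containsP. Qed.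

Lemma occurs_transfer (m n k : nat) (r : 'I_m -> nat) (p : 'I_n -> nat)
    (D : {set 'I_n}) (e : 'I_m -> 'I_n) (q : 'S_k) :
  (forall i j : 'I_m, (i < j) = (e i < e j)) ->
  (forall i j, (r i < r j) = (p (e i) < p (e j))) ->
  (forall x, x \in D <-> exists i, e i = x) ->
  occurs p D q <-> occurs r [set: 'I_m] q.
Proof.
move=> einc erord eD; split=> [[f [fD fi fo]]|[f [_ fi fo]]].
  have /choice[g gE] a : exists i, e i = f a by apply/eD.
  by exists g; split=> [a|a b ab|a b]; rewrite ?in_setT // ?einc ?erord !gE //; exact: fi.
exists (e \o f); split=> [a|a b ab|a b] /=.
- by apply/eD; exists (f a).
- by rewrite -einc fi.
- by rewrite -erord fo.
Qed.

(* The [i]-th smallest element of [D] when [#|D| = m]; the default value of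
   [nth] only serves to inhabit ['I_(c + m)]. *)
Definition nth_elt (c m : nat) (D : {set 'I_(c + m)}) (i : 'I_m) : 'I_(c + m) :=
  nth (rshift c i) (enum D) i.

Lemma mem_nth_elt (c m : nat) (D : {set 'I_(c + m)}) (i : 'I_m) :
  #|D| = m -> nth_elt D i \in D.
Proof. by move=> cD; rewrite -mem_enum mem_nth // -cardE cD. Qed.

Lemma sorted_enum_ord (n : nat) (D : {set 'I_n}) :
  sorted (relpre (@nat_of_ord n) ltn) (enum D).
Proof.
rewrite /enum_mem; apply: sorted_filter; first by move=> x y z; exact: ltn_trans.
rewrite -enumT; have := iota_ltn_sorted 0 n; rewrite -val_enum_ord.
by rewrite sorted_map.
Qed.

Lemma ltn_nth_elt (c m : nat) (D : {set 'I_(c + m)}) (i j : 'I_m) :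
  #|D| = m -> (i < j) = (nth_elt D i < nth_elt D j).
Proof.
move=> cD.
have mono (a b : 'I_m) : a < b -> nth_elt D a < nth_elt D b.
  move=> ab; rewrite /nth_elt (set_nth_default (rshift c b)) -?cardE ?cD //.
  apply: (sorted_ltn_nth (leT := relpre (@nat_of_ord _) ltn)) => //.
  - by move=> x y z; exact: ltn_trans.
  - exact: sorted_enum_ord.
  - by rewrite inE -cardE cD.
  - by rewrite inE -cardE cD.
case: (ltngtP i j) => [lt|gt|/val_inj ->]; last by rewrite ltnn.
  by rewrite mono.
by symmetry; apply/negbTE; rewrite -leqNgt ltnW // mono.
Qed.

Lemma nth_elt_inj (c m : nat) (D : {set 'I_(c + m)}) :
  #|D| = m -> injective (nth_elt D).
Proof.
move=> cD i j eqe; apply: val_inj => /=.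
have := ltn_nth_elt i j cD; have := ltn_nth_elt j i cD; rewrite eqe ltnn.
by case: ltngtP.
Qed.

Lemma nth_elt_surj (c m : nat) (D : {set 'I_(c + m)}) x :
  #|D| = m -> x \in D <-> exists i, nth_elt D i = x.
Proof.
move=> cD; split=> [xD|[i <-]]; last exact: mem_nth_elt.
have lt : index x (enum D) < m by rewrite -[X in _ < X]cD cardE index_mem mem_enum.
by exists (Ordinal lt); rewrite /nth_elt nth_index // mem_enum.
Qed.

(** * Marked permutations *)

Definition decreasing_on (n : nat) (p : 'S_n) (W : {set 'I_n}) : Prop :=
  {in W &, forall i j : 'I_n, i < j -> p j < p i}.

Definition marked (k : nat) (q : 'S_k) (n c : nat) : {set 'S_n * {set 'I_n}} :=
  [set x : 'S_n * {set 'I_n} | [&& #|x.2| == c, `[< decreasing_on x.1 x.2 >]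
             & `[< ~ occurs (fun i => x.1 i) (~: x.2) q >]]].

Lemma decreasing_onE (n : nat) (p : 'S_n) (W : {set 'I_n}) :
  decreasing_on p W -> {in W &, forall i j : 'I_n, (p i < p j) = (j < i)}.
Proof.
move=> dec i j iW jW; case: (ltngtP j i) => [lt|gt|/val_inj ->].
- by rewrite dec.
- by apply/negbTE; rewrite -leqNgt ltnW // dec.
- by rewrite ltnn.
Qed.

Lemma decreasing_on_inj (n : nat) (p1 p2 : 'S_n) (W : {set 'I_n}) :
  decreasing_on p1 W -> decreasing_on p2 W -> p1 @: W = p2 @: W ->
  {in W, p1 =1 p2}.
Proof.
move=> dec1 dec2 eqV x xW; apply: val_inj; move: x xW.
apply: (@eq_in_order _ W (fun i => p1 i) (fun i => p2 i)) => [i j iW jW|i iW|i iW].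
- by rewrite (decreasing_onE dec1) ?(decreasing_onE dec2).
- have : p1 i \in p2 @: W by rewrite -eqV imset_f.
  by case/imsetP => y yW ->; exists y.
- have : p2 i \in p1 @: W by rewrite eqV imset_f.
  by case/imsetP => y yW ->; exists y.
Qed.

(** The last component is the standardisation of the unmarked entries. It is pinned by comparisons
    only, so the relation suits [card_le_rel] in both directions. *)
Definition marked_data (c m : nat) (x : 'S_(c + m) * {set 'I_(c + m)})
    (y : {set 'I_(c + m)} * {set 'I_(c + m)} * 'S_m) : Prop :=
  [/\ y.1.1 = x.2, y.1.2 = x.1 @: x.2
    & forall i j, (y.2 i < y.2 j)
                    = (x.1 (nth_elt (~: x.2) i) < x.1 (nth_elt (~: x.2) j))].

Lemma card_setC_ord (c m : nat) (W : {set 'I_(c + m)}) : #|W| = c -> #|~: W| = m.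
Proof. by move=> cW; rewrite cardsCs setCK card_ord cW addKn. Qed.

Definition marked_codes (k : nat) (q : 'S_k) (c m : nat) :=
  setX (setX [set W : {set 'I_(c + m)} | #|W| == c] [set W : {set 'I_(c + m)} | #|W| == c])
    [set r : 'S_m | avoids r q].

Lemma card_marked_codes (k : nat) (q : 'S_k) (c m : nat) :
  #|marked_codes q c m| = 'C(c + m, c) ^ 2 * num_avoiders q m.
Proof. by rewrite !cardsX card_draws card_ord mulnn. Qed.

Lemma markedP (k : nat) (q : 'S_k) (n c : nat) (x : 'S_n * {set 'I_n}) :
  reflect [/\ #|x.2| = c, decreasing_on x.1 x.2
            & ~ occurs (fun i => x.1 i) (~: x.2) q] (x \in marked q n c).
Proof.
rewrite inE; apply: (iffP and3P) => [[/eqP ? /asboolP ? /asboolP ?]|[? ? ?]] //.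
by split; [apply/eqP|apply/asboolP|apply/asboolP].
Qed.

Lemma marked_data_occurs (k : nat) (q : 'S_k) (c m : nat)
    (x : 'S_(c + m) * {set 'I_(c + m)}) y :
  #|x.2| = c -> @marked_data c m x y ->
  occurs (fun i => x.1 i) (~: x.2) q <-> occurs (fun i => y.2 i) [set: 'I_m] q.
Proof.
move=> /card_setC_ord cW [_ _ ord].
apply: (@occurs_transfer _ _ _ _ _ _ (nth_elt (~: x.2))) => //.
- by move=> i j; exact: ltn_nth_elt.
- by move=> z; exact: nth_elt_surj.
Qed.

(** The data determine the permutation: marked values decrease, so their set fixes their places;
    unmarked values fill the complement in the order of the standardisation. *)
Lemma card_marked_le (k : nat) (q : 'S_k) (c m : nat) :
  #|marked q (c + m) c| <= 'C(c + m, c) ^ 2 * num_avoiders q m.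
Proof.
rewrite -card_marked_codes; apply: (@card_le_rel _ _ _ _ (@marked_data c m)).
  move=> [s W] /markedP[/= cW dec noc].
  have cW' := card_setC_ord cW.
  have [|r rE] := @perm_of_order m (fun i => s (nth_elt (~: W) i)).
    by move=> i j /val_inj/perm_inj/(nth_elt_inj cW').
  exists (W, s @: W, r); last by split.
  rewrite !in_setX !inE /= cW card_imset ?cW; last exact: perm_inj.
  rewrite eqxx /=; apply/avoidsP => occ; apply: noc.
  by apply/(@marked_data_occurs _ q c m (s, W) (W, s @: W, r)).
move=> [s1 W1] [s2 W2] [[W V] r] /markedP[/= cW1 dec1 _] /markedP[/= cW2 dec2 _].
move=> [/= -> -> ord1] [/= eqW eqV ord2]; subst W2; congr pair.
have cW' := card_setC_ord cW1.
have eqW := decreasing_on_inj dec1 dec2 eqV.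
have imC (s : 'S_(c + m)) : s @: (~: W1) = ~: (s @: W1).
  by apply/setP => z; rewrite -[z](permKV s) inE !mem_imset ?inE //; exact: perm_inj.
have eqVC : s1 @: (~: W1) = s2 @: (~: W1) by rewrite !imC eqV.
apply/permP => x; have [xW|xW] := boolP (x \in W1); first exact: eqW.
apply: val_inj; have {xW} xW : x \in ~: W1 by rewrite inE.
move: x xW.
apply: (@eq_in_order _ (~: W1) (fun i => s1 i) (fun i => s2 i)) => [i j iW jW|i iW|i iW].
- have /(nth_elt_surj _ cW')[i' <-] := iW; have /(nth_elt_surj _ cW')[j' <-] := jW.
  by rewrite -ord1 -ord2.
- have : s1 i \in s2 @: ~: W1 by rewrite -eqVC imset_f.
  by case/imsetP => y yW ->; exists y.
- have : s2 i \in s1 @: ~: W1 by rewrite eqVC imset_f.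
  by case/imsetP => y yW ->; exists y.
Qed.

Lemma card_marked_ge (k : nat) (q : 'S_k) (c m : nat) :
  'C(c + m, c) ^ 2 * num_avoiders q m <= #|marked q (c + m) c|.
Proof.
rewrite -card_marked_codes.
apply: (@card_le_rel _ _ _ _ (fun y x => @marked_data c m x y)); last first.
  move=> [[W V] r] [[W' V'] r'] [s W''] _ _ [/= -> -> ord] [/= -> -> ord'].
  by congr pair; apply: perm_eq_order => i j; rewrite ord ord'.
move=> [[W V] r]; rewrite !in_setX !inE /= => /andP[/andP[/eqP cW /eqP cV] /avoidsP noc].
have cW' := card_setC_ord cW; have cV' := card_setC_ord cV.
pose seqV (U : {set 'I_(c + m)}) := [seq val i | i <- enum U].
have seqVuniq U : uniq (seqV U) by rewrite map_inj_uniq ?enum_uniq //; exact: val_inj.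
have seqVsize U : size (seqV U) = #|U| by rewrite size_map -cardE.
have seqVP U x : x \in seqV U -> exists2 i, i \in U & x = val i.
  by case/mapP => i; rewrite mem_enum; exists i.
(* The key [c + m - i] reverses the positions, so the values of [V] are placed decreasingly on
   [W]. *)
have [| | |h1 h1V h1ord] := @fit_order _ W (seqV V) (fun i => c + m - i).
- by move=> i j _ _; have := ltn_ord i; have := ltn_ord j => ? ? ?; apply: val_inj => /=; lia.
- exact: seqVuniq.
- by rewrite seqVsize cV.
pose e := nth_elt (~: W).
have einj : injective e by exact: nth_elt_inj.
(* The default 0 is taken only on [W], whereas [g] is compared only on the complement. *)
pose g x := if [pick i | e i == x] is Some i then val (r i) else 0.
have gE i : g (e i) = r i.
  rewrite /g; case: pickP => [j /eqP/einj -> //|/(_ i)].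
  by rewrite eqxx.
have [| | |h2 h2V h2ord] := @fit_order _ (~: W) (seqV (~: V)) g.
- move=> x y /(nth_elt_surj _ cW')[i <-] /(nth_elt_surj _ cW')[j <-].
  by rewrite !gE => /val_inj/perm_inj ->.
- exact: seqVuniq.
- by rewrite seqVsize cV' cW'.
pose h x := if x \in W then h1 x else h2 x.
have [x|x y|s sE] := @perm_of_nat _ h.
- rewrite /h; case: ifPn => xW; first by have [i _ ->] := seqVP _ _ (h1V x xW); exact: ltn_ord.
  have xW' : x \in ~: W by rewrite inE.
  by have [i _ ->] := seqVP _ _ (h2V x xW'); exact: ltn_ord.
- rewrite /h; case: ifPn => xW; case: ifPn => yW eqh.
  + have := h1ord x y xW yW; have := h1ord y x yW xW; rewrite eqh ltnn.
    by have := ltn_ord x; have := ltn_ord y => ? ? ? ?; apply: val_inj => /=; lia.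
  + have yW' : y \in ~: W by rewrite inE.
    have [i iV ei] := seqVP _ _ (h1V x xW); have [j jV ej] := seqVP _ _ (h2V y yW').
    by move: eqh jV; rewrite ei ej inE => /val_inj <-; rewrite iV.
  + have xW' : x \in ~: W by rewrite inE.
    have [i iV ei] := seqVP _ _ (h2V x xW'); have [j jV ej] := seqVP _ _ (h1V y yW).
    by move: eqh iV; rewrite ei ej inE => /val_inj ->; rewrite jV.
  + have xW' : x \in ~: W by rewrite inE.
    have yW' : y \in ~: W by rewrite inE.
    have := h2ord x y xW' yW'; have := h2ord y x yW' xW'; rewrite eqh ltnn.
    move/(nth_elt_surj _ cW'): xW' => [i <-]; move/(nth_elt_surj _ cW'): yW' => [j <-].
    rewrite -/(e i) -/(e j) !gE => lt1 lt2; congr e; apply: (@perm_inj _ r).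
    by apply: val_inj => /=; lia.
have dat : marked_data (s, W) (W, V, r).
  split=> //=.
    have sub : s @: W \subset V.
      apply/subsetP => _ /imsetP[x xW ->].
      have [i iV ei] := seqVP _ _ (h1V x xW).
      suff -> : s x = i by [].
      by apply: val_inj; rewrite -ei /= sE /h xW.
    by apply/esym/eqP; rewrite eqEcard sub (card_imset _ (@perm_inj _ s)) cV cW /=.
  move=> i j; rewrite !sE /h.
  have eW l : e l \in ~: W by exact: mem_nth_elt.
  have eW' l : (e l \in W) = false by have := eW l; rewrite inE => /negbTE.
  by rewrite -/(e i) -/(e j) !eW' h2ord // !gE.
exists (s, W) => //; apply/markedP; split=> //=.
  by move=> i j iW jW ij; rewrite !sE /h iW jW h1ord //; have := ltn_ord j; lia.
by move/(@marked_data_occurs _ q c m (s, W) (W, V, r)) => occ; apply: noc; exact: occ.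
Qed.

(** * Left-to-right minima and skew sums *)

Lemma prepend_min0 (k : nat) (q : 'S_k) : prepend_min q ord0 = ord0.
Proof. exact: lift_perm_id. Qed.

Lemma prepend_minS (k : nat) (q : 'S_k) (a : 'I_k) :
  prepend_min q (lift ord0 a) = (q a).+1 :> nat.
Proof. by rewrite /prepend_min lift_perm_lift. Qed.

Definition lr_minima (n : nat) (p : 'S_n) : {set 'I_n} :=
  [set i : 'I_n | [forall j : 'I_n, (j < i) ==> (p i < p j)]].

Lemma lr_minimaP (n : nat) (p : 'S_n) (i : 'I_n) :
  reflect (forall j : 'I_n, j < i -> p i < p j) (i \in lr_minima p).
Proof.
rewrite inE; apply: (iffP forallP) => H j; first exact: implyP (H j).
by apply/implyP; exact: H.
Qed.

(** If [q] occurred off the left-to-right minima, some entry would precede and lie below its first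
    entry. That first entry is both leftmost and smallest, so the extra entry would complete an
    occurrence of [prepend_min q]. *)
Lemma avoids_prepend_min_marked (k : nat) (q : 'S_k.+1) (n : nat) (p : 'S_n) :
  q ord0 = ord0 -> avoids p (prepend_min q) ->
  (p, lr_minima p) \in marked q n #|lr_minima p|.
Proof.
move=> q0 /avoidsP noc; apply/markedP; split=> //= [i j iM /lr_minimaP jM|].
  exact: jM.
move=> [f [fM fi fo]]; apply: noc.
have : f ord0 \notin lr_minima p by have := fM ord0; rewrite inE.
rewrite inE negb_forall => /existsP[j]; rewrite negb_imply -leqNgt => /andP[j_lt pj_le].
have pj_lt : p j < p (f ord0).
  rewrite ltn_neqAle pj_le andbT; apply: contraTneq j_lt => /val_inj/perm_inj ->.
  by rewrite ltnn.
have f0_le a : f ord0 <= f a.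
  by have [->//|a0] := eqVneq a ord0; rewrite ltnW // fi // lt0n.
have pf0_le a : p (f ord0) <= p (f a).
  by rewrite leqNgt fo q0.
exists (fun a => if unlift ord0 a is Some b then f b else j).
split=> [a|a b|a b]; first exact: in_setT.
- case: unliftP => [a' ->|->]; case: unliftP => [b' ->|->] //.
  + by rewrite !lift0 ltnS; exact: fi.
  + by rewrite (leq_trans j_lt).
- case: unliftP => [a' ->|->]; case: unliftP => [b' ->|->] //=;
    rewrite ?prepend_minS ?prepend_min0 ?ltnS ?fo ?ltnn //=.
  + by apply/negbTE; rewrite -leqNgt ltnW // (leq_trans pj_lt).
  + by rewrite (leq_trans pj_lt).
Qed.

(** Avoiders are sorted by their number [c] of left-to-right minima, and each is marked at these
    minima. *)
Lemma num_avoiders_prepend_min_le (k : nat) (q : 'S_k.+1) (n : nat) :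
  q ord0 = ord0 ->
  num_avoiders (prepend_min q) n <= \sum_(c < n.+1) 'C(n, c) ^ 2 * num_avoiders q (n - c).
Proof.
move=> q0; have card_lt (p : 'S_n) : #|lr_minima p| < n.+1.
  by rewrite ltnS -[X in _ <= X]card_ord max_card.
rewrite /num_avoiders -sum1_card.
rewrite (partition_big (fun p => Ordinal (card_lt p)) xpredT) //=.
apply: leq_sum => c _; have cn : c <= n by rewrite -ltnS.
apply: (@leq_trans #|marked q n c|); last first.
  by move: (subnKC cn) (card_marked_le q c (n - c)) => ->.
have pair_inj : injective (fun p : 'S_n => (p, lr_minima p)) by move=> p p' [].
rewrite sum1dep_card -(card_imset _ pair_inj).
apply: subset_leq_card; apply/subsetP => _ /imsetP[p + ->].
rewrite inE => /andP[]; rewrite inE => pav /eqP pc.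
have -> : nat_of_ord c = #|lr_minima p| by rewrite -pc.
exact: avoids_prepend_min_marked.
Qed.

(* The skew sum of two avoiders avoids [q]: an occurrence of [q] lies in the block
   of its first entry, because that entry is also the smallest. *)
Lemma num_avoiders_supermul (k : nat) (q : 'S_k.+1) (m n : nat) :
  q ord0 = ord0 ->
  num_avoiders q m * num_avoiders q n <= num_avoiders q (m + n).
Proof.
move=> q0; rewrite /num_avoiders -cardsX.
pose rel (x : 'S_m * 'S_n) (p : 'S_(m + n)) :=
  (forall i, p (lshift n i) = x.1 i + n :> nat) /\
  (forall j, p (rshift m j) = x.2 j :> nat).
apply: (@card_le_rel _ _ _ _ rel); last first.
  move=> [p1 p2] [p1' p2'] p _ _ [/= L R] [/= L' R'].
  congr pair; apply/permP => i; apply: val_inj => /=.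
    by have := L i; rewrite L'; lia.
  by rewrite -R R'.
move=> [p1 p2]; rewrite in_setX !inE /= => /andP[/avoidsP av1 /avoidsP av2].
pose h (x : 'I_(m + n)) : nat :=
  match split x with inl i => p1 i + n | inr j => p2 j end.
have [x|x y|p pE] := @perm_of_nat _ h.
- by rewrite /h; case: split => i; [rewrite ltn_add2r|apply: ltn_addl].
- rewrite -[x]splitK -[y]splitK /h !unsplitK.
  case: (split x) => i; case: (split y) => j /= eqh.
  + by have /val_inj/perm_inj -> : p1 i = p1 j :> nat by lia.
  + by have := ltn_ord (p2 j); lia.
  + by have := ltn_ord (p2 i); lia.
  + by move/val_inj/perm_inj: eqh => ->.
have pL i : p (lshift n i) = p1 i + n :> nat.
  by rewrite pE /h -[lshift n i]/(unsplit (inl i)) unsplitK.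
have pR j : p (rshift m j) = p2 j :> nat.
  by rewrite pE /h -[rshift m j]/(unsplit (inr j)) unsplitK.
exists p => //; rewrite inE; apply/avoidsP => -[f [_ fi fo]].
have f0_le a : f ord0 <= f a.
  by have [->//|a0] := eqVneq a ord0; rewrite ltnW // fi // lt0n.
have pf0_le a : p (f ord0) <= p (f a).
  by rewrite leqNgt fo q0.
case: (splitP (f ord0)) => [i f0|j f0].
  have /choice[f' f'E] a : exists i, f a = lshift n i.
    case: (splitP (f a)) => [i' fa|j fa].
      by exists i'; apply: val_inj.
    have := pf0_le a; have -> : f ord0 = lshift n i by apply: val_inj.
    have -> : f a = rshift m j by apply: val_inj.
    by rewrite pL pR; have := ltn_ord (p2 j); lia.
  apply: av1; exists f'; split=> [a|a b ab|a b]; first exact: in_setT.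
    by have := fi a b ab; rewrite !f'E.
  by rewrite -fo !f'E !pL ltn_add2r.
have /choice[f' f'E] a : exists j, f a = rshift m j.
  case: (splitP (f a)) => [i' fa|j' fa].
    by have := f0_le a; rewrite f0 fa; have := ltn_ord i'; lia.
  by exists j'; apply: val_inj.
apply: av2; exists f'; split=> [a|a b ab|a b]; first exact: in_setT.
  by have := fi a b ab; rewrite !f'E /= ltn_add2l.
by rewrite -fo !f'E !pR.
Qed.

(** * The staircase construction *)

Definition low_positions (n d : nat) (p : 'S_n) : {set 'I_n} := [set i : 'I_n | p i < d].

Lemma card_low_positions (n d : nat) (p : 'S_n) : d <= n -> #|low_positions d p| = d.
Proof.
move=> dn; have -> : low_positions d p = [set p^-1%g (widen_ord dn i) | i : 'I_d].
  apply/setP => x; rewrite inE; apply/idP/imsetP => [xd|[i _ ->]].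
    by exists (Ordinal xd) => //; apply: (@perm_inj _ p); rewrite permKV; apply: val_inj.
  by rewrite permKV /=.
rewrite card_imset ?card_ord // => i j /perm_inj/(congr1 val) /= eqij.
exact: val_inj.
Qed.

(** The decreasing condition is the invariant of the induction: it allows the positions of the [d]
    smallest values to be reused when the next marked permutation is attached. *)
Definition staircase (k : nat) (q : 'S_k) (d n : nat) : {set 'S_n} :=
  [set p : 'S_n | avoids p q && `[< decreasing_on p (low_positions d p) >]].

Lemma staircaseP (k : nat) (q : 'S_k) (d n : nat) (p : 'S_n) :
  reflect (~ occurs (fun i => p i) [set: 'I_n] q /\ decreasing_on p (low_positions d p))
    (p \in staircase q d n).
Proof.
rewrite inE; apply: (iffP andP) => -[H1 H2]; first by split; [apply/avoidsP|apply/asboolP].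
by split; [apply/avoidsP|apply/asboolP].
Qed.

(* The old positions [B] of the [d = c + 1] smallest values and the new marked
   positions receive, decreasingly, the new marked values and the [d] smallest
   values. As [d > c], some old position gets a value below [d], so that every new
   marked entry lies below all the other new ones. *)
Lemma staircase_supermul (k : nat) (q : 'S_k.+1) (c n N : nat) :
  q ord0 = ord0 -> c < n ->
  #|staircase (prepend_min q) c.+1 n| * #|marked q N c|
    <= #|staircase (prepend_min q) c.+1 (n + N)|.
Proof.
move=> q0; set d := c.+1 => dn; rewrite -cardsX.
(* Both factors can be read off [p]: the old one from the order on the left block, [W] from the
   right entries below [d], and the unmarked part of [s] from the other right entries. *)
pose rel (x : 'S_n * ('S_N * {set 'I_N})) (p : 'S_(n + N)) :=
  [/\ forall i j, (x.1 i < x.1 j) = (p (lshift N i) < p (lshift N j)),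
      forall j, (j \in x.2.2) = (p (rshift n j) < d)
    & forall j, j \notin x.2.2 -> p (rshift n j) = d + x.2.1 j :> nat].
apply: (@card_le_rel _ _ _ _ rel); last first.
  move=> [p1 [s1 W1]] [p2 [s2 W2]] p; rewrite !in_setX.
  move=> /andP[_ /markedP[/= _ dec1 _]] /andP[_ /markedP[/= _ dec2 _]].
  move=> [/= ord1 eW1 eC1] [/= ord2 eW2 eC2].
  have eW : W2 = W1 by apply/setP => j; rewrite eW1 eW2.
  subst W2; congr (_, (_, _)); first by apply: perm_eq_order => i j; rewrite ord1 ord2.
  have eqC j : j \notin W1 -> s1 j = s2 j.
    by move=> jW; apply: val_inj; have := eC1 j jW; rewrite eC2 //= => /addnI.
  (* The marked values are those missed by the unmarked entries, on which [s1] and [s2] agree. *)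
  have eqV : s1 @: W1 = s2 @: W1.
    apply/setP => z; rewrite -[in LHS](permKV s1 z) -[in RHS](permKV s2 z).
    rewrite !mem_imset; try exact: perm_inj.
    have [zW|zW] := boolP (s1^-1%g z \in W1); last first.
      by rewrite -[in RHS](permKV s1 z) eqC // permK (negbTE zW).
    apply/esym; apply: contraTT zW => zW.
    by rewrite -[in X in X \notin _](permKV s2 z) -eqC // permK.
  have eqW := decreasing_on_inj dec1 dec2 eqV.
  by apply/permP => j; have [/eqW|/eqC] := boolP (j \in W1).
move=> [p [s W]]; rewrite in_setX /= => /andP[/staircaseP[pav pdec] /markedP[/= cW sdec sav]].
pose B := [set x : 'I_(n + N) |
  match split x with inl i => p i < d | inr j => j \in W end].
have BL i : (lshift N i \in B) = (p i < d).
  by rewrite inE -[lshift N i]/(unsplit (inl i)) unsplitK.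
have BR j : (rshift n j \in B) = (j \in W).
  by rewrite inE -[rshift n j]/(unsplit (inr j)) unsplitK.
have cB : #|B| = d + c.
  have -> : B = (@lshift n N @: low_positions d p) :|: (@rshift n N @: W).
    apply/setP => x; rewrite -[x]splitK in_setU.
    case: (split x) => i; rewrite [unsplit _]/= ?BL ?BR.
      rewrite mem_imset ?inE; last exact: lshift_inj.
      rewrite [X in _ || X](_ : _ = false) ?orbF //.
      by apply/negbTE/imsetP => -[j _ /(congr1 val)] /=; have := ltn_ord i; lia.
    rewrite [X in _ = _ || X]mem_imset; last exact: rshift_inj.
    rewrite [X in X || _](_ : _ = false) //.
    by apply/negbTE/imsetP => -[j _ /(congr1 val)] /=; have := ltn_ord j; lia.
  rewrite cardsU (card_imset _ (@lshift_inj n N)) (card_imset _ (@rshift_inj n N)).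
  rewrite card_low_positions // cW [X in _ - X](_ : _ = 0) ?subn0 //.
  apply/eqP; rewrite cards_eq0 -subset0; apply/subsetP => x.
  rewrite inE => /andP[/imsetP[i _ ->] /imsetP[j _ /(congr1 val)]] /=.
  by have := ltn_ord i; lia.
pose V2 := [seq d + s j | j <- enum W].
have V2P v : v \in V2 -> exists2 j, j \in W & v = d + s j.
  by case/mapP => j; rewrite mem_enum; exists j.
have szV2 : size V2 = c by rewrite size_map -cardE.
pose V := iota 0 d ++ V2.
have [| | |h hV hord] := @fit_order _ B V (fun x => n + N - x).
- by move=> x y _ _; have := ltn_ord x; have := ltn_ord y => ? ? ?; apply: val_inj => /=; lia.
- rewrite cat_uniq iota_uniq andTb map_inj_uniq ?enum_uniq ?andbT; last first.
    by move=> i j /addnI/val_inj/perm_inj.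
  by apply/hasPn => v /V2P[j _ ->]; rewrite mem_iota /=; lia.
- by rewrite size_cat szV2 size_iota cB.
have {}hV x : x \in B -> h x < d \/ exists2 j, j \in W & h x = d + s j.
  move=> /hV; rewrite mem_cat mem_iota /= add0n => /orP[|/V2P]; [by left|by right].
have {}hord x y : x \in B -> y \in B -> (h x < h y) = (y < x).
  by move=> xB yB; rewrite hord //; have := ltn_ord x; have := ltn_ord y; lia.
have h_lt x : x \in B -> h x < d + N.
  by case/hV => [|[j _ ->]]; [lia|rewrite ltn_add2l].
(* Values from [d] to [d + N - 1] are reserved for the entries of [s], so old values at least [d]
   move up by [N]. The low values and the marked values of [s] go to [B]. *)
pose key x := if x \in B then h x else
  match split x with inl i => p i + N | inr j => d + s j end.
have keyB x : x \in B -> key x = h x by rewrite /key => ->.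
have keyL i : lshift N i \notin B -> key (lshift N i) = p i + N.
  by rewrite /key => /negbTE ->; rewrite -[lshift N i]/(unsplit (inl i)) unsplitK.
have keyR j : rshift n j \notin B -> key (rshift n j) = d + s j.
  by rewrite /key => /negbTE ->; rewrite -[rshift n j]/(unsplit (inr j)) unsplitK.
have keyN x : x \notin B ->
    (exists2 i, d <= p i & x = lshift N i /\ key x = p i + N) \/
    (exists2 j, j \notin W & x = rshift n j /\ key x = d + s j).
  rewrite -[x]splitK; case: (split x) => i; rewrite [unsplit _]/= => xB.
    by left; exists i; [move: xB; rewrite BL -leqNgt|rewrite keyL].
  by right; exists i; [move: xB; rewrite BR|rewrite keyR].
have keyBN x y : x \in B -> y \notin B -> key x <> key y.
  move=> xB /keyN[[i pi [_ ->]]|[j jW [_ ->]]]; rewrite keyB //.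
    by have := h_lt x xB; lia.
  case: (hV x xB) => [|[j' j'W ->]]; first lia.
  by move=> /addnI/val_inj/perm_inj eqj; move: jW; rewrite -eqj j'W.
have [x|x y eqk|p'' pE] := @perm_of_nat _ key.
- have [xB|/keyN[[i _ [_ ->]]|[j _ [_ ->]]]] := boolP (x \in B).
  + by rewrite keyB //; have := h_lt x xB; lia.
  + by have := ltn_ord (p i); lia.
  + by have := ltn_ord (s j); lia.
- have [xB|xB] := boolP (x \in B); have [yB|yB] := boolP (y \in B).
  + move: eqk; rewrite !keyB // => eqk; apply: val_inj => /=.
    have := hord x y xB yB; have := hord y x yB xB; rewrite eqk ltnn; lia.
  + by case: (keyBN x y).
  + by case: (keyBN y x).
  + move: eqk; case: (keyN x xB) => [[i pi [-> ->]]|[i iW [-> ->]]];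
      case: (keyN y yB) => [[j pj [-> ->]]|[j jW [-> ->]]].
    * by move/addIn/val_inj/perm_inj ->.
    * by have := ltn_ord (s j); lia.
    * by have := ltn_ord (s i); lia.
    * by move/addnI/val_inj/perm_inj ->.
have lowB x : p'' x < d -> x \in B.
  rewrite pE => lt; apply: contraLR lt => /keyN[[i pi [_ ->]]|[j _ [_ ->]]];
  by rewrite -leqNgt; lia.
have pB : {in B &, forall x y : 'I_(n + N), (p'' x < p'' y) = (y < x)}.
  by move=> x y xB yB; rewrite !pE !keyB // hord.
(* Pigeonhole: otherwise the [d] old positions of [B] would receive distinct values from [V2], which
   has only [c] elements. *)
have [x0 [x0B x0n x0d]] : exists x0 : 'I_(n + N), [/\ x0 \in B, x0 < n & p'' x0 < d].
  apply: contrapT => none.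
  have sub : {subset [seq h (lshift N i) | i <- enum (low_positions d p)] <= V2}.
    move=> _ /mapP[i + ->]; rewrite mem_enum inE -BL => iB.
    case: (hV _ iB) => [lt|[j jW ->]]; last first.
      by apply: map_f; rewrite mem_enum.
    by case: none; exists (lshift N i); split=> //=; rewrite pE keyB.
  have /uniq_leq_size : uniq [seq h (lshift N i) | i <- enum (low_positions d p)].
    rewrite map_inj_in_uniq ?enum_uniq // => i j; rewrite !mem_enum !inE -!BL => iB jB eqh.
    have := hord _ _ iB jB; have := hord _ _ jB iB; rewrite eqh ltnn /= => ? ?.
    by apply: val_inj => /=; lia.
  by move/(_ _ sub); rewrite szV2 size_map -cardE card_low_positions // ltnn.
have newB j : j \in W -> p'' (rshift n j) < d.
  move=> jW; apply: ltn_trans x0d; rewrite pB ?BR //=.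
  by apply: leq_trans x0n _; rewrite leq_addr.
have ordL i j : (p i < p j) = (p'' (lshift N i) < p'' (lshift N j)).
  have [iB|iB] := boolP (lshift N i \in B); have [jB|jB] := boolP (lshift N j \in B).
  + by rewrite pB //= (decreasing_onE pdec) // inE -BL.
  + rewrite !pE (keyB _ iB) (keyL _ jB); have := h_lt _ iB.
    by move: iB jB; rewrite !BL; lia.
  + rewrite !pE (keyL _ iB) (keyB _ jB); have := h_lt _ jB.
    by move: iB jB; rewrite !BL; lia.
  + by rewrite !pE !keyL // ltn_add2r.
have relP : rel (p, (s, W)) p''.
  split=> //= [j|j jW]; last by rewrite pE keyR // BR.
  apply/idP/idP => [|/lowB]; [exact: newB|by rewrite BR].
exists p'' => //; apply/staircaseP; split; last first.
  by move=> x y; rewrite !inE => /lowB xB /lowB yB xy; rewrite pB.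
move=> [f [_ fi fo]].
pose f1 := f (lift ord0 ord0).
have f1_le a : f1 <= f (lift ord0 a).
  have [->//|a0] := eqVneq a ord0; rewrite ltnW // fi // !lift0 ltnS.
  by rewrite lt0n.
have pf1_le a : p'' f1 <= p'' (f (lift ord0 a)).
  by rewrite leqNgt fo !prepend_minS q0.
have f0a a : f ord0 < f (lift ord0 a) by rewrite fi // lift0.
have pf0a a : p'' (f ord0) < p'' (f (lift ord0 a)).
  by rewrite fo prepend_min0 prepend_minS.
(* [f1] carries the first entry of the copy of [q]. If it is old, so is [f ord0], and the ascent
   between them forces [d <= p i]. Every later entry then lies above all the new ones, so the whole
   occurrence is old. *)
case: (splitP f1) => [i|j] f1E.
  have {}f1E : f1 = lshift N i by exact: val_inj.
  case: (splitP (f ord0)) => [i0|j0] f0E; last first.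
    by have := f0a ord0; rewrite -/f1 f1E f0E /=; have := ltn_ord i; lia.
  have {}f0E : f ord0 = lshift N i0 by exact: val_inj.
  have lt_i : i0 < i by have := f0a ord0; rewrite -/f1 f1E f0E.
  have lt_pi : p i0 < p i by rewrite ordL -f1E -f0E; exact: pf0a.
  have pi_ge : d <= p i.
    rewrite leqNgt; apply/negP => pid; have pi0d := ltn_trans lt_pi pid.
    by move: (pdec i0 i); rewrite !inE => /(_ pi0d pid lt_i); lia.
  have /choice[f' f'E] a : exists i, f a = lshift N i.
    have [a' ->|->] := unliftP ord0 a; last by exists i0.
    case: (splitP (f (lift ord0 a'))) => [i'|j'] faE; first by exists i'; exact: val_inj.
    have {}faE : f (lift ord0 a') = rshift n j' by exact: val_inj.
    have := pf1_le a'; rewrite faE f1E (pE (lshift N i)) keyL ?BL -?leqNgt //.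
    have [jW|jW] := boolP (j' \in W); first by have := newB j' jW; lia.
    by rewrite pE keyR ?BR //; have := ltn_ord (s j'); lia.
  apply: pav; exists f'; split=> [a|a b ab|a b]; first exact: in_setT.
    by have := fi a b ab; rewrite !f'E.
  by rewrite -fo !f'E ordL.
(* If [f1] is new, the copy of [q] lies in the new block. A marked entry of it would be below [d],
   hence so would [f ord0]: both would be in [B], where there are no ascents. *)
have /choice[f' f'E] a : exists j, f (lift ord0 a) = rshift n j /\ j \notin W.
  case: (splitP (f (lift ord0 a))) => [i'|j'] faE.
    by have := f1_le a; rewrite f1E faE; have := ltn_ord i'; lia.
  have {}faE : f (lift ord0 a) = rshift n j' by exact: val_inj.
  exists j'; split=> //; apply/negP => jW.
  have := pf0a a; rewrite faE => lt; have lt' := ltn_trans lt (newB _ jW).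
  move: lt; rewrite pB ?BR ?lowB //; have := f0a a; rewrite faE; lia.
apply: sav; exists f'; split=> [a|a b ab|a b].
- by rewrite inE; case: (f'E a).
- case: (f'E a) (f'E b) => [ea _] [eb _].
  have : f (lift ord0 a) < f (lift ord0 b) by rewrite fi // !lift0.
  by rewrite ea eb /= ltn_add2l.
- case: (f'E a) (f'E b) => [ea aW] [eb bW].
  have := fo (lift ord0 a) (lift ord0 b); rewrite !prepend_minS ltnS => <-.
  by rewrite ea eb !pE !keyR ?BR // ltn_add2l.
Qed.

(** The first two entries of [q] form an ascent, and the decreasing permutation has none. *)
Lemma rev_ord_avoids (k : nat) (q : 'S_k.+2) (n : nat) :
  q ord0 = ord0 -> ~ occurs (fun i => perm (@rev_ord_inj n) i) [set: 'I_n] q.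
Proof.
move=> q0 [f [_ fi fo]].
have lt : f ord0 < f (lift ord0 ord0) by exact: fi.
have q1 : q (lift ord0 ord0) != ord0 by rewrite -[X in _ != X]q0 (inj_eq perm_inj).
have := fo ord0 (lift ord0 ord0); rewrite q0 !permE lt0n [X in _ = X]q1 /=.
by have := ltn_ord (f (lift ord0 ord0)); lia.
Qed.

Lemma num_avoiders_gt0 (k : nat) (q : 'S_k.+2) (n : nat) :
  q ord0 = ord0 -> 0 < num_avoiders q n.
Proof.
move=> q0; apply/card_gt0P; exists (perm (@rev_ord_inj n)).
by rewrite inE; apply/avoidsP; exact: rev_ord_avoids.
Qed.

Lemma staircase_base (k : nat) (q : 'S_k.+1) (d : nat) :
  0 < #|staircase (prepend_min q) d d|.
Proof.
apply/card_gt0P; exists (perm (@rev_ord_inj d)); apply/staircaseP.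
split=> [|i j _ _ ij]; first by apply: rev_ord_avoids; exact: prepend_min0.
by rewrite !permE /=; have := ltn_ord j; lia.
Qed.

(** The staircase starts with the decreasing permutation of length [c.+1], and each of the [s]
    attachments multiplies the count by at least the number of marked permutations. *)
Lemma num_avoiders_prepend_min_ge (k : nat) (q : 'S_k.+1) (c m s : nat) :
  q ord0 = ord0 ->
  ('C(c + m, c) ^ 2 * num_avoiders q m) ^ s
    <= num_avoiders (prepend_min q) (c.+1 + s * (c + m)).
Proof.
move=> q0; apply: (@leq_trans #|staircase (prepend_min q) c.+1 (c.+1 + s * (c + m))|).
  elim: s => [|s IHs]; first by rewrite addn0 staircase_base.
  rewrite expnSr (_ : c.+1 + s.+1 * (c + m) = c.+1 + s * (c + m) + (c + m)).
    apply: leq_trans (staircase_supermul _ q0 _); last by rewrite ltn_addr.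
    by rewrite leq_mul // card_marked_ge.
  by rewrite mulSn; lia.
by apply: subset_leq_card; apply/subsetP => p; rewrite !inE => /andP[].
Qed.

(** * The theorem of Marcus and Tardos *)

(* 0-1 matrices are represented by the set of their nonzero cells. *)
Definition mx_contains (n k : nat) (A : {set 'I_n * 'I_n}) (q : 'S_k) : Prop :=
  exists f g : 'I_k -> 'I_n,
    [/\ forall a b : 'I_k, a < b -> f a < f b, forall a b : 'I_k, a < b -> g a < g b
      & forall a, (f a, g (q a)) \in A].

Definition transpose (n : nat) (A : {set 'I_n * 'I_n}) : {set 'I_n * 'I_n} :=
  [set z : 'I_n * 'I_n | (z.2, z.1) \in A].

Lemma mx_contains_transpose (n k : nat) (A : {set 'I_n * 'I_n}) (q : 'S_k) :
  mx_contains (transpose A) q^-1%g -> mx_contains A q.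
Proof.
move=> [f [g [fi gi fg]]]; exists g, f; split=> // a.
by have := fg (q a); rewrite inE permK.
Qed.

Lemma incr_fun_in (n k : nat) (D : {set 'I_n}) :
  k <= #|D| -> exists2 e : 'I_k -> 'I_n,
    forall a b : 'I_k, a < b -> e a < e b & forall a, e a \in D.
Proof.
move=> kD; exists (fun a => enum_val (widen_ord kD a)) => [a b ab|a]; last exact: enum_valP.
have x0 : 'I_n by exact: enum_val (widen_ord kD a).
rewrite !(enum_val_nth x0).
apply: (sorted_ltn_nth (leT := relpre (@nat_of_ord _) ltn)) => //.
- by move=> x y z; exact: ltn_trans.
- exact: sorted_enum_ord.
- by rewrite inE -cardE (leq_trans (ltn_ord a)).
- by rewrite inE -cardE (leq_trans (ltn_ord b)).
Qed.

(* [b] sends an index to the index of the block that contains it. *)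
Definition blocks (n m t : nat) (b : 'I_n -> 'I_m) : Prop :=
  (forall x y : 'I_n, b x < b y -> x < y) /\ (forall i, #|[set x | b x == i]| <= t).

Definition block_cols (n m : nat) (b : 'I_n -> 'I_m) (A : {set 'I_n * 'I_n})
    (i j : 'I_m) : {set 'I_n} :=
  [set y | (b y == j) && [exists x, (b x == i) && ((x, y) \in A)]].

Definition contraction (n m : nat) (b : 'I_n -> 'I_m) (A : {set 'I_n * 'I_n}) :
    {set 'I_m * 'I_m} :=
  [set (b z.1, b z.2) | z in A].

(** Each cell of the contraction lifts to a cell of [A] in its block, and cells in distinct block
    rows or columns keep their order. *)
Lemma contraction_avoids (n m k t : nat) (b : 'I_n -> 'I_m) (A : {set 'I_n * 'I_n})
    (q : 'S_k) :
  blocks t b -> mx_contains (contraction b A) q -> mx_contains A q.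
Proof.
move=> [bmono _] [f [g [fi gi fg]]].
have /choice[z zE] a : exists z, [/\ z \in A, f a = b z.1 & g (q a) = b z.2].
  by case/imsetP: (fg a) => z zA [-> ->]; exists z.
exists (fun a => (z a).1), (fun a => (z (q^-1%g a)).2); split=> [a c ac|a c ac|a].
- apply: bmono; have [_ <- _] := zE a; have [_ <- _] := zE c; exact: fi.
- apply: bmono; have [_ _ <-] := zE (q^-1%g a); have [_ _ <-] := zE (q^-1%g c).
  by rewrite !permKV gi.
- by rewrite permK -surjective_pairing; have [] := zE a.
Qed.

(* Pigeonhole: [k] wide blocks with the same nonempty columns would contain every
   pattern of length [k]. *)
Lemma card_wide_blocks (n m k t : nat) (b : 'I_n -> 'I_m) (A : {set 'I_n * 'I_n})
    (q : 'S_k) (j : 'I_m) :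
  blocks t b -> ~ mx_contains A q ->
  #|[set i | k <= #|block_cols b A i j|]| <= k * 2 ^ t.
Proof.
move=> [bmono bfib] noc; set D := [set i | _].
pose F := [set x | b x == j].
have colsF i : block_cols b A i j \in powerset F.
  by rewrite inE; apply/subsetP => y; rewrite !inE => /andP[].
rewrite -sum1_card (partition_big (fun i => block_cols b A i j) (mem (powerset F))) /=; last first.
  by move=> i _; exact: colsF.
apply: (@leq_trans (\sum_(C in powerset F) k)); last first.
  by rewrite sum_nat_const card_powerset mulnC leq_mul2l leq_exp2l ?bfib ?orbT.
apply: leq_sum => C _; rewrite sum1dep_card leqNgt; apply/negP => /ltnW kC.
have [r rinc rD] := incr_fun_in kC.
apply: noc; case: k q @D kC r rinc rD => [q|k q] D kC r rinc rD.
  have f : 'I_0 -> 'I_n by case.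
  by exists f, f; split=> -[].
have kC' : k.+1 <= #|C|.
  by have := rD ord0; rewrite /D !inE => /andP[+ /eqP <-].
have [g ginc gC] := incr_fun_in kC'.
have /choice[f fE] a : exists x, b x = r a /\ (x, g (q a)) \in A.
  have := gC (q a); have := rD a; rewrite inE => /andP[_ /eqP <-].
  by rewrite inE => /andP[_ /existsP[x /andP[/eqP bx xA]]]; exists x.
exists f, g; split=> // [a c ac|a]; last by case: (fE a).
by apply: bmono; have [-> _] := fE a; have [-> _] := fE c; exact: rinc.
Qed.

(** A nonempty block that is neither wide nor tall has at most [k ^ 2] cells; any other has at most
    [t ^ 2], and there are at most [m * k * 2 ^ t] wide ones and as many tall ones. *)
Lemma card_block_recursion (n m k t : nat) (b : 'I_n -> 'I_m) (A : {set 'I_n * 'I_n})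
    (q : 'S_k) :
  blocks t b -> ~ mx_contains A q ->
  #|A| <= k ^ 2 * #|contraction b A| + 2 * t ^ 2 * k * 2 ^ t * m.
Proof.
move=> bP noc; have [bmono bfib] := bP.
pose wide i j := k <= #|block_cols b A i j|.
(* Nonempty rows are the nonempty columns of the transpose, which avoids the inverse pattern. *)
pose tall i j := k <= #|block_cols b (transpose A) j i|.
pose block i j := [set z in A | (b z.1 == i) && (b z.2 == j)].
have blockE i j : #|block i j| <= k ^ 2 * ((i, j) \in contraction b A)
    + (t ^ 2 * wide i j + t ^ 2 * tall i j).
  have [inC|notinC] := boolP ((i, j) \in contraction b A); last first.
    rewrite (_ : block i j = set0) ?cards0 //; apply/setP => z; rewrite !inE.
    apply: contraNF notinC => /andP[zA /andP[/eqP <- /eqP <-]].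
    by apply/imsetP; exists z.
  have sub : block i j \subset
      setX (block_cols b (transpose A) j i) (block_cols b A i j).
    apply/subsetP => -[x y]; rewrite !inE /= => /andP[xyA /andP[bx by_]].
    rewrite bx by_ /=; apply/andP; split; apply/existsP.
      by exists y; rewrite inE by_.
    by exists x; rewrite bx.
  have le1 := subset_leq_card sub; rewrite cardsX in le1.
  have le2 i' j' A' : #|block_cols b A' i' j'| <= t.
    apply: leq_trans (bfib j'); apply: subset_leq_card.
    by apply/subsetP => y; rewrite !inE => /andP[].
  have le3 : #|block i j| <= t ^ 2.
    by apply: leq_trans le1 _; rewrite -mulnn leq_mul.
  have [w|w] := boolP (wide i j); first by rewrite muln1; lia.
  have [ta|ta] := boolP (tall i j); first by rewrite muln1; lia.
  rewrite muln1 !muln0 !addn0; apply: leq_trans le1 _; rewrite -mulnn.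
  by rewrite leq_mul // ltnW // ltnNge.
have -> : #|A| = \sum_i \sum_j #|block i j|.
  rewrite pair_big -sum1_card (partition_big (fun z => (b z.1, b z.2)) xpredT) //=.
  apply: eq_bigr => -[i j] _; rewrite sum1dep_card; apply: eq_card => z.
  by rewrite !inE xpair_eqE.
apply: (@leq_trans (\sum_i \sum_j (k ^ 2 * ((i, j) \in contraction b A)
    + (t ^ 2 * wide i j + t ^ 2 * tall i j)))).
  by apply: leq_sum => i _; apply: leq_sum => j _; exact: blockE.
have -> : \sum_i \sum_j (k ^ 2 * ((i, j) \in contraction b A)
    + (t ^ 2 * wide i j + t ^ 2 * tall i j)) =
  k ^ 2 * (\sum_i \sum_j ((i, j) \in contraction b A : nat)) +
  (t ^ 2 * (\sum_j \sum_i (wide i j : nat)) + t ^ 2 * (\sum_i \sum_j (tall i j : nat))).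
  rewrite (exchange_big_dep xpredT) //= [X in t ^ 2 * X + _]exchange_big /=.
  rewrite [LHS]exchange_big /=.
  rewrite !big_distrr /= -!big_split /=; apply: eq_bigr => i _.
  by rewrite !big_distrr /= -!big_split.
have card_bool (T : finType) (P : pred T) : \sum_i (P i : nat) = #|[set i | P i]|.
  by rewrite -[RHS]sum1dep_card [RHS]big_mkcond /=; apply: eq_bigr => i _; case: (P i).
have sumC : \sum_i \sum_j ((i, j) \in contraction b A : nat) = #|contraction b A|.
  rewrite pair_big /= -[RHS]sum1_card [RHS]big_mkcond /=.
  by apply: eq_bigr => -[i j] _ /=; case: (_ \in _).
have sumW : \sum_j \sum_i (wide i j : nat) <= m * (k * 2 ^ t).
  rewrite -[X in X * _]card_ord -sum_nat_const; apply: leq_sum => j _.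
  by rewrite card_bool; exact: card_wide_blocks bP noc.
have sumT : \sum_i \sum_j (tall i j : nat) <= m * (k * 2 ^ t).
  rewrite -[X in X * _]card_ord -sum_nat_const; apply: leq_sum => i _.
  rewrite card_bool; apply: (@card_wide_blocks _ _ _ _ _ _ q^-1%g) => // H.
  exact/noc/mx_contains_transpose.
rewrite sumC leq_add2l.
apply: (@leq_trans (t ^ 2 * (m * (k * 2 ^ t)) + t ^ 2 * (m * (k * 2 ^ t)))).
  by rewrite leq_add // leq_mul2l ?sumW ?sumT orbT.
by set X := t ^ 2; set Y := 2 ^ t; lia.
Qed.

Lemma exists_blocks (n m t : nat) :
  0 < t -> n = m * t -> exists b : 'I_n -> 'I_m, blocks t b.
Proof.
move=> t0 nE; have lt (x : 'I_n) : x %/ t < m by rewrite ltn_divLR // -nE.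
exists (fun x => Ordinal (lt x)); split=> [x y /=|i].
  by apply: contraLR; rewrite -!leqNgt; exact: leq_div2r.
pose r (x : 'I_n) := Ordinal (ltn_pmod x t0).
rewrite -(@card_in_imset _ _ r) => [|x y].
  by rewrite -[X in _ <= X]card_ord max_card.
rewrite !inE -!val_eqE /= => /eqP xi /eqP yi /(congr1 val) /= eqr.
by apply: val_inj; rewrite /= (divn_eq x t) (divn_eq y t) xi yi eqr.
Qed.

(** This is [E + 1] with [E] the coefficient of [m] in the recursion. As [k ^ 2 + 1 <= t], it
    satisfies [k ^ 2 * (E + 1) + E <= t * (E + 1)], so the linear bound propagates from [t ^ l] to
    [t ^ l.+1]. *)
Definition block_const (k : nat) : nat :=
  let t := k.+1 ^ 2 in 2 * t ^ 2 * k * 2 ^ t + 1.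

Lemma card_mx_avoider (k : nat) (q : 'S_k) (l : nat) :
  let t := k.+1 ^ 2 in
  forall A : {set 'I_(t ^ l) * 'I_(t ^ l)},
    ~ mx_contains A q -> #|A| <= block_const k * t ^ l.
Proof.
move=> t; elim: l => [|l IHl] A noc.
  apply: leq_trans (max_card _) _.
  by rewrite card_prod !card_ord expn0 muln1 /block_const addn1.
have [b bP] := exists_blocks (isT : 0 < t) (expnSr t l).
have := IHl _ (fun H => noc (contraction_avoids bP H)).
have := card_block_recursion bP noc.
rewrite [X in _ -> _ -> _ <= _ * X]expnSr /block_const -/t; set E := 2 * _ * _ * _; set C := #|contraction b A|.
set T := t ^ l => H1 H2.
have tE : k ^ 2 + 1 <= t by rewrite /t -!mulnn; lia.
apply: (@leq_trans ((k ^ 2 + 1) * ((E + 1) * T))); last first.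
  by rewrite [X in _ <= X]mulnA [X in _ <= X]mulnC leq_mul2r tE orbT.
rewrite mulnDl mul1n; apply: leq_trans H1 _.
by rewrite leq_add ?leq_mul2l ?H2 ?orbT // leq_mul2r leq_addr orbT.
Qed.

Definition mx_avoiders (k : nat) (q : 'S_k) (n : nat) : {set {set 'I_n * 'I_n}} :=
  [set A | `[< ~ mx_contains A q >]].

(** Klazar's reduction: a matrix is given by its contraction, again an avoider, and a subset of the
    cells above it. The linear bound leaves at most [t ^ 2 * block_const k * t ^ l] such cells, and
    these exponents add up geometrically. *)
Lemma card_mx_avoiders (k : nat) (q : 'S_k) (l : nat) :
  let t := k.+1 ^ 2 in 0 < k ->
  #|mx_avoiders q (t ^ l)| <= 2 ^ ((t ^ 2 * block_const k + 1) * t ^ l).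
Proof.
move=> t k0; elim: l => [|l IHl].
  apply: (@leq_trans #|powerset [set: 'I_(t ^ 0) * 'I_(t ^ 0)]|).
    by apply: subset_leq_card; apply/subsetP => A _; rewrite inE subsetT.
  by rewrite card_powerset cardsT card_prod !card_ord leq_exp2l // expn0 muln1 addn1.
have [b bP] := exists_blocks (isT : 0 < t) (expnSr t l); have [_ bfib] := bP.
set E := block_const k in IHl *; set T := t ^ l in b bP bfib IHl *.
apply: (@leq_trans (#|mx_avoiders q T| * 2 ^ (t ^ 2 * (E * T)))).
  rewrite -[X in X <= _]sum1_card.
  rewrite (partition_big (contraction b) (mem (mx_avoiders q T))) /=; last first.
    move=> A; rewrite !inE => /asboolP noc; apply/asboolP => H; apply: noc.
    exact: contraction_avoids bP H.
  rewrite -sum_nat_const; apply: leq_sum => C; rewrite inE => /asboolP Cnoc.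
  pose P := [set z : 'I_(t ^ l.+1) * 'I_(t ^ l.+1) | (b z.1, b z.2) \in C].
  apply: (@leq_trans #|powerset P|).
    rewrite sum1dep_card; apply: subset_leq_card; apply/subsetP => A.
    rewrite !inE => /andP[_ /eqP AC]; apply/subsetP => z zA.
    by rewrite inE -AC; apply/imsetP; exists z.
  rewrite card_powerset leq_exp2l //.
  apply: (@leq_trans (t ^ 2 * #|C|)); last by rewrite leq_mul2l (card_mx_avoider Cnoc) orbT.
  rewrite -sum1_card (partition_big (fun z => (b z.1, b z.2)) (mem C)) /=; last first.
    by move=> z; rewrite inE.
  rewrite mulnC -sum_nat_const; apply: leq_sum => -[i j] ijC.
  rewrite sum1dep_card.
  apply: (@leq_trans #|setX [set x | b x == i] [set x | b x == j]|); last first.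
    by rewrite cardsX -mulnn leq_mul.
  apply: subset_leq_card; apply/subsetP => z.
  by rewrite !inE xpair_eqE => /andP[_].
apply: leq_trans (leq_mul IHl (leqnn _)) _.
rewrite -expnD leq_exp2l // [t ^ l.+1]expnSr -/T.
have t2 : 2 <= t by rewrite /t -mulnn; nia.
set G := t ^ 2; apply: (@leq_trans ((G * E + 1) * (T * 2))); first by lia.
by rewrite !leq_mul2l t2 !orbT.
Qed.

Lemma num_avoiders_le_mx (k : nat) (q : 'S_k) (n : nat) :
  num_avoiders q n <= #|mx_avoiders q n|.
Proof.
pose graph (p : 'S_n) := [set z : 'I_n * 'I_n | p z.1 == z.2].
have graph_inj : injective graph.
  move=> p p' /setP eqg; apply/permP => i; apply/eqP.
  by have := eqg (i, p' i); rewrite !inE /= eqxx.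
rewrite /num_avoiders -(card_imset _ graph_inj); apply: subset_leq_card.
apply/subsetP => _ /imsetP[p + ->]; rewrite !inE => /avoidsP noc.
apply/asboolP => -[f [g [fi gi fg]]]; apply: noc; exists f; split=> // [a|a b].
  exact: in_setT.
have := fg a; have := fg b; rewrite !inE /= => /eqP -> /eqP ->.
case: (ltngtP (q a) (q b)) => [lt|gt|/val_inj -> ]; last by rewrite ltnn.
  exact: gi.
by apply/negbTE; rewrite -leqNgt ltnW // gi.
Qed.

(* The matrix bound is available at the powers of [t] only; it extends to all
   lengths because [num_avoiders q] is nondecreasing. *)
Lemma num_avoiders_exp_bound (k : nat) (q : 'S_k.+2) :
  q ord0 = ord0 -> exists C : nat, forall n, num_avoiders q n <= C ^ n.
Proof.
move=> q0; pose t := k.+3 ^ 2; pose F := t ^ 2 * block_const k.+2 + 1.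
(* The factor [t] pays for rounding the length up to a power of [t]: [t ^ l.+1] is at most [t] times
   the length. *)
exists (2 ^ (F * t)) => -[|n].
  by rewrite expn0; apply: leq_trans (max_card _) _; rewrite card_Sn.
have t2 : 1 < t by rewrite /t -mulnn.
have /andP[lo hi] := trunc_log_bounds t2 (isT : 0 < n.+1).
set l := trunc_log t n.+1 in lo hi.
apply: (@leq_trans (num_avoiders q (t ^ l.+1))).
  rewrite -(subnKC (ltnW hi)).
  apply: leq_trans (num_avoiders_supermul _ _ q0).
  by rewrite leq_pmulr // num_avoiders_gt0.
apply: leq_trans (num_avoiders_le_mx _ _) _.
apply: leq_trans (card_mx_avoiders q l.+1 isT) _.
by rewrite -[X in _ <= X]expnM leq_exp2l // -/t -/F -mulnA leq_mul2l expnS leq_mul2l lo !orbT.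
Qed.

Local Open Scope classical_set_scope.
Local Open Scope ring_scope.

(** * Growth rates *)

Lemma bernoulli_ineq (R : realType) (d : R) (n : nat) :
  0 <= d -> 1 + d *+ n <= (1 + d) ^+ n.
Proof.
move=> d0; elim: n => [|n IHn]; first by rewrite mulr0n addr0 expr0.
rewrite exprS; apply: (@le_trans _ _ ((1 + d) * (1 + d *+ n))).
  by rewrite mulrSr; have := mulr_ge0 d0 (mulrn_wge0 n d0); set y := d *+ n; lra.
by rewrite ler_wpM2l // addr_ge0.
Qed.

Lemma expr_unbounded (R : realType) (r K : R) :
  1 < r -> exists n0 : nat, forall n, (n0 <= n)%N -> K < r ^+ n.
Proof.
move=> r1; pose d := r - 1; have d0 : 0 < d by rewrite subr_gt0.
exists (Num.bound (`|K| / d)) => n le_n.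
have : `|K| / d < n%:R.
  apply: lt_le_trans (archi_boundP _) _; first by rewrite divr_ge0 // ltW.
  by rewrite ler_nat.
rewrite ltr_pdivrMr // mulrC mulr_natr => ltK.
apply: le_lt_trans (ler_norm K) (lt_le_trans ltK _).
rewrite (_ : r = 1 + d); last by rewrite /d addrC subrK.
by apply: le_trans (bernoulli_ineq n (ltW d0)); rewrite lerDr.
Qed.

Lemma expr_le_const (R : realType) (x y K : R) :
  0 <= x -> 0 < y -> (forall n, x ^+ n <= K * y ^+ n) -> x <= y.
Proof.
move=> x0 y0 H; rewrite leNgt; apply/negP => yx.
have [|n0 /(_ n0 (leqnn _))] := @expr_unbounded _ (x / y) K.
  by rewrite ltr_pdivlMr // mul1r.
by rewrite expr_div_n ltr_pdivlMr ?exprn_gt0 // ltNge H.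
Qed.

Lemma expr_le_linear (R : realType) (x y K : R) :
  0 <= x -> 0 < y -> 0 <= K -> (forall n, x ^+ n <= n.+1%:R * K * y ^+ n) -> x <= y.
Proof.
move=> x0 y0 K0 H; apply/ler_addgt0Pr => e e0.
(* [d <= e / y] gives [y * (1 + d) <= y + e], and [d <= 1] gives [d * n.+1 <= 1 + d * n], so
   Bernoulli absorbs the linear factor into [(1 + d) ^+ n]. *)
pose d := Num.min 1 (e / y).
have d0 : 0 < d by rewrite lt_min ltr01 divr_gt0.
have d1 : d <= 1 by rewrite ge_min lexx.
have dy : y * d <= e by rewrite mulrC -ler_pdivlMr // ge_min lexx orbT.
apply: (@le_trans _ _ (y * (1 + d))); last by rewrite mulrDr mulr1 lerD2l.
apply: (@expr_le_const _ _ _ (K / d)) => //; first by rewrite mulr_gt0 // addr_gt0.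
move=> n; apply: le_trans (H n) _; rewrite exprMn.
have : n.+1%:R <= d^-1 * (1 + d) ^+ n.
  rewrite mulrC ler_pdivlMr // mulr_natl.
  apply: le_trans (bernoulli_ineq n (ltW d0)).
  by rewrite mulrS lerD2r.
move=> le_n; apply: (@le_trans _ _ (d^-1 * (1 + d) ^+ n * (K * y ^+ n))).
  by rewrite -mulrA ler_wpM2r // mulr_ge0 // exprn_ge0 // ltW.
by rewrite le_eqVlt; apply/orP; left; apply/eqP; ring.
Qed.

Lemma powR_inv_expr (R : realType) (x : R) (n : nat) :
  0 <= x -> (0 < n)%N -> (x `^ n%:R^-1) ^+ n = x.
Proof.
move=> x0 n0; rewrite -powR_mulrn ?powR_ge0 // -powRrM mulVf ?powRr1 //.
by rewrite pnatr_eq0 -lt0n.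
Qed.

Lemma supermul_expr (R : realType) (a : nat -> R) (m s : nat) :
  (forall n, 1 <= a n) -> (forall m n, a m * a n <= a (m + n)%N) ->
  a m ^+ s <= a (s * m)%N.
Proof.
move=> a1 amul; elim: s => [|s IHs]; first by rewrite expr0 a1.
rewrite exprS mulSn; apply: le_trans (amul _ _).
by rewrite ler_wpM2l // (le_trans ler01).
Qed.

(** Divide [n] by [m]: the full blocks contribute at most [a n] by supermultiplicativity, and the
    remainder, a power below the [m]-th, at most [a m]. *)
Lemma supermul_root_expr (R : realType) (a : nat -> R) (m n : nat) :
  (forall n, 1 <= a n) -> (forall m n, a m * a n <= a (m + n)%N) -> (0 < m)%N ->
  (a m `^ m%:R^-1) ^+ n <= a m * a n.
Proof.
move=> a1 amul m0; have a0 i : 0 <= a i by exact: le_trans ler01 (a1 i).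
set x := _ `^ _.
have xm : x ^+ m = a m by rewrite powR_inv_expr.
have x1 : 1 <= x.
  by rewrite -(@ler_pXn2r _ m) ?nnegrE ?powR_ge0 // xm expr1n.
have xr : x ^+ (n %% m)%N <= a m.
  by rewrite -xm ler_weXn2l // ltnW // ltn_mod.
rewrite [in X in X <= _](divn_eq n m) exprD mulnC exprM xm mulrC.
apply: ler_pM => //; rewrite ?exprn_ge0 ?(le_trans ler01 x1) //.
apply: le_trans (supermul_expr _ _ a1 amul) _.
rewrite [in X in _ <= X](divn_eq n m); apply: le_trans (amul _ _).
by rewrite ler_peMr.
Qed.

(* Fekete's lemma for supermultiplicative sequences. *)
Lemma supermul_root_cvg (R : realType) (a : nat -> R) (C : R) :
  (forall n, 1 <= a n) -> (forall m n, a m * a n <= a (m + n)%N) ->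
  0 <= C -> (forall n, a n <= C ^+ n) ->
  exists L : R, [/\ (fun n => a n `^ n%:R^-1) @ \oo --> L, 1 <= L,
    forall n, a n <= L ^+ n
    & forall z, (forall n, (0 < n)%N -> a n `^ n%:R^-1 <= z) -> L <= z].
Proof.
move=> a1 amul C0 aC; have a0 i : 0 <= a i by exact: le_trans ler01 (a1 i).
pose root n := a n `^ n%:R^-1.
have rootX n : (0 < n)%N -> root n ^+ n = a n by move=> n0; rewrite /root powR_inv_expr.
have root0 n : 0 <= root n by exact: powR_ge0.
have root_ge n y : (0 < n)%N -> 0 <= y -> y ^+ n <= a n -> y <= root n.
  by move=> n0 y0; rewrite -[X in _ <= X](rootX n n0) ler_pXn2r ?nnegrE.
have root_le n y : (0 < n)%N -> 0 <= y -> a n <= y ^+ n -> root n <= y.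
  by move=> n0 y0; rewrite -[X in X <= _](rootX n n0) ler_pXn2r ?nnegrE.
pose E := [set root n | n in [set n | (0 < n)%N]]%classic.
have hsE : has_sup E.
  split; first by exists (root 1%N); exists 1%N.
  by exists C => _ [n n0 <-]; apply: root_le.
pose L := sup E.
have rootL n : (0 < n)%N -> root n <= L.
  by move=> n0; apply: ub_le_sup; [exact: hsE.2 | exists n].
have L1 : 1 <= L.
  by apply: le_trans (rootL 1%N isT); apply: root_ge; rewrite ?expr1n.
have lub z : (forall n, (0 < n)%N -> root n <= z) -> L <= z.
  by move=> H; apply: ge_sup; [exact: hsE.1 | move=> _ [n n0 <-]; exact: H].
exists L; split=> //; last first.
  move=> [|n]; first by rewrite expr0; have := aC 0%N; rewrite expr0.
  by rewrite -[X in X <= _]rootX // ler_pXn2r ?nnegrE ?rootL // (le_trans ler01).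
apply/cvgrPdist_le => e e0.
(* The cap at one half keeps [y] positive, since [1 <= L]. *)
pose y := L - Num.min e 2^-1.
have y0 : 0 < y.
  rewrite subr_gt0; apply: lt_le_trans L1.
  by rewrite gt_min; apply/orP; right; rewrite invf_lt1 ?ltr1n.
have yL : y < L by rewrite ltrBlDr ltrDl lt_min e0 invr_gt0 ltr0n.
have [m m0 ym] : exists2 m, (0 < m)%N & y < root m.
  apply: contrapT => none; move: yL; rewrite ltNge => /negP; apply; apply: lub => n n0.
  by rewrite leNgt; apply/negP => lt; apply: none; exists n.
(* From [n0] on, [root m ^+ n] exceeds [a m * y ^+ n], which outweighs the factor [a m] lost in
   [supermul_root_expr]. *)
have [|n0 Hn0] := @expr_unbounded _ (root m / y) (a m).
  by rewrite ltr_pdivlMr // mul1r.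
exists n0.+1 => // n /= n0n.
have n_gt0 : (0 < n)%N by exact: leq_trans n0n.
rewrite ger0_norm ?subr_ge0 ?rootL // lerBlDr -lerBlDl.
apply: (@le_trans _ _ y); first by rewrite lerD2l lerN2 ge_min lexx.
apply: root_ge => //; first exact: ltW.
have := Hn0 n (ltnW n0n); rewrite expr_div_n ltr_pdivlMr ?exprn_gt0 // => lt.
have am0 : 0 < a m by exact: lt_le_trans ltr01 (a1 m).
rewrite -(ler_pM2l am0); apply: le_trans (ltW lt) _.
exact: supermul_root_expr.
Qed.

(** Applied to the terms of the binomial expansion of [(1 + Num.sqrt L) ^+ n], whose squares bound
    the marked counts. *)
Lemma sum_sqr_le (R : realType) (n : nat) (t : 'I_n -> R) :
  (forall i, 0 <= t i) -> \sum_i t i ^+ 2 <= (\sum_i t i) ^+ 2.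
Proof.
move=> t0; rewrite expr2 mulr_suml; apply: ler_sum => i _.
rewrite expr2 ler_wpM2l // (bigD1 i) //= lerDl; apply: sumr_ge0 => j _; exact: t0.
Qed.

Lemma root_limit_relation (R : realType) (a b : nat -> nat) (C : nat) :
  (forall n, 0 < a n)%N -> (forall m n, a m * a n <= a (m + n))%N ->
  (forall n, a n <= C ^ n)%N ->
  (forall n, 0 < b n)%N -> (forall m n, b m * b n <= b (m + n))%N ->
  (forall n, b n <= \sum_(c < n.+1) 'C(n, c) ^ 2 * a (n - c))%N ->
  (forall c m s, ('C(c + m, c) ^ 2 * a m) ^ s <= b (c.+1 + s * (c + m)))%N ->
  exists L : R, [/\ 0 <= L, (fun n => ((a n)%:R : R) `^ n%:R^-1) @ \oo --> L
    & (fun n => ((b n)%:R : R) `^ n%:R^-1) @ \oo --> 1 + L + 2 * Num.sqrt L].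
Proof.
move=> a0 amul aC b0 bmul ble bge.
pose ra n : R := (a n)%:R; pose rb n : R := (b n)%:R.
have ra1 n : 1 <= ra n by rewrite ler1n.
have rb1 n : 1 <= rb n by rewrite ler1n.
have ramul m n : ra m * ra n <= ra (m + n)%N by rewrite -natrM ler_nat.
have rbmul m n : rb m * rb n <= rb (m + n)%N by rewrite -natrM ler_nat.
have [|n|L [aL L1 aLn Llub]] := @supermul_root_cvg R ra C%:R ra1 ramul.
- exact: ler0n.
- by rewrite -natrX ler_nat.
have L0 : 0 <= L by exact: le_trans ler01 L1.
pose D := (1 + Num.sqrt L) ^+ 2.
have sL0 : 0 <= Num.sqrt L by exact: sqrtr_ge0.
have bD n : rb n <= D ^+ n.
  apply: (@le_trans _ _ (\sum_(c < n.+1) (Num.sqrt L ^+ (n - c) *+ 'C(n, c)) ^+ 2)).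
    apply: (@le_trans _ _ (\sum_(c < n.+1) ('C(n, c) ^ 2 * a (n - c))%N%:R)).
      by rewrite -natr_sum ler_nat.
    apply: ler_sum => c _; rewrite -[X in _ <= X ^+ 2]mulr_natr exprMn exprAC sqr_sqrtr //.
    by rewrite natrM natrX mulrC ler_wpM2r ?sqr_ge0 //; exact: aLn.
  apply: le_trans (sum_sqr_le _) _; first by move=> i; rewrite mulrn_wge0 // exprn_ge0.
  rewrite /D exprAC [1 + _]addrC [X in _ <= X ^+ 2]exprDn le_eqVlt; apply/orP; left.
  by apply/eqP; congr (_ ^+ 2); apply: eq_bigr => i _; rewrite expr1n mulr1.
have [|L' [bL' L'1 bLn L'lub]] := @supermul_root_cvg R rb D rb1 rbmul _ bD.
  exact: sqr_ge0.
have L'0 : 0 <= L' by exact: le_trans ler01 L'1.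
have L'_gt0 : 0 < L' by exact: lt_le_trans ltr01 L'1.
have DE : D = 1 + L + 2 * Num.sqrt L.
  by rewrite /D sqrrD expr1n sqr_sqrtr // mul1r -mulr_natl; ring.
suff L'E : L' = D by exists L; split=> //; rewrite -DE -L'E.
apply/le_anti/andP; split.
  apply: L'lub => n n0; rewrite -(@ler_pXn2r _ n) ?nnegrE ?powR_ge0 ?sqr_ge0 //.
  by rewrite powR_inv_expr // ler0n.
(* As [s] grows, the extra length [c.+1] of the staircase costs only the constant factor
   [L' ^+ c.+1]. *)
have marked_le c m : ('C(c + m, c)%:R) ^+ 2 * ra m <= L' ^+ (c + m).
  apply: (@expr_le_const _ _ _ (L' ^+ c.+1)).
  - by rewrite mulr_ge0 ?sqr_ge0 ?ler0n.
  - exact: exprn_gt0.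
  move=> s; rewrite -exprM mulnC -exprD; apply: le_trans (bLn _).
  by rewrite -natrX -natrM -natrX ler_nat.
have sL'1 : 1 <= Num.sqrt L' by rewrite -sqrtr1 ler_sqrt.
(* As [L] is the supremum of the roots, it suffices to treat each root [x], whose powers are bounded
   by [a] up to the constant factor [ra M]. *)
suff le_root M : (0 < M)%N -> 1 + Num.sqrt (ra M `^ M%:R^-1) <= Num.sqrt L'.
  have : L <= (Num.sqrt L' - 1) ^+ 2.
    apply: Llub => n n0; have := le_root n n0; set x := _ `^ _ => le_x.
    have x0 : 0 <= x by exact: powR_ge0.
    rewrite -[X in X <= _](sqr_sqrtr x0) ler_pXn2r ?nnegrE ?sqrtr_ge0 ?subr_ge0 //.
    by rewrite lerBrDl.
  move=> /ler_wsqrtr; rewrite sqrtr_sqr ger0_norm ?subr_ge0 // lerBrDl => le_sL.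
  by rewrite /D -[X in _ <= X](sqr_sqrtr L'0) ler_pXn2r ?nnegrE ?sqrtr_ge0 //.
move=> M0; set x := ra M `^ _; have x0 : 0 <= x by exact: powR_ge0.
have sx0 : 0 <= Num.sqrt x by exact: sqrtr_ge0.
apply: (@expr_le_linear _ _ _ (Num.sqrt (ra M))).
- by rewrite addr_ge0.
- by rewrite sqrtr_gt0.
- exact: sqrtr_ge0.
move=> n; rewrite addrC exprDn.
apply: (@le_trans _ _ (\sum_(c < n.+1) Num.sqrt (ra M) * Num.sqrt L' ^+ n)); last first.
  by rewrite sumr_const card_ord -mulrA mulr_natl.
(* Termwise, the square of a binomial term is at most [ra M * L' ^+ n] by [marked_le]; the [n.+1]
   terms account for the linear factor. *)
apply: ler_sum => c _; rewrite expr1n mulr1; have cn : (c <= n)%N by rewrite -ltnS.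
rewrite -(@ler_pXn2r _ 2) ?nnegrE ?mulrn_wge0 ?mulr_ge0 ?exprn_ge0 ?sqrtr_ge0 //.
rewrite -[X in X ^+ 2 <= _]mulr_natr !exprMn ![(_ ^+ _) ^+ 2]exprAC !sqr_sqrtr //.
apply: (@le_trans _ _ (ra M * ra (n - c)%N * 'C(n, c)%:R ^+ 2)).
  by rewrite ler_wpM2r ?sqr_ge0 // supermul_root_expr.
rewrite -mulrA ler_wpM2l ?ler0n // mulrC.
by have := marked_le c (n - c)%N; rewrite subnKC.
Qed.

(** * Patterns of length one, and the limit formula *)

Lemma cvg_growth_limit (R : realType) (k : nat) (q : 'S_k) (l : R) :
  (fun n => ((num_avoiders q n)%:R : R) `^ n%:R^-1) @ \oo --> l ->
  growth_limit R q = l.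
Proof. by move=> H; apply: cvg_lim => //; exact: Rhausdorff. Qed.

Lemma num_avoiders_length1 (q : 'S_1) (n : nat) : num_avoiders q n.+1 = 0%N.
Proof.
apply: eq_card0 => p; rewrite inE; apply/negbTE/negPn/containsP.
exists (fun=> ord0); split=> [a|a b|a b]; first exact: in_setT.
  by rewrite !ord1 ltnn.
by rewrite !ord1 !ltnn.
Qed.

(** Only the summand [c = n] of the upper bound survives, as only the empty permutation avoids
    [q]. *)
Lemma num_avoiders_prepend_min_length1 (q : 'S_1) (n : nat) :
  num_avoiders (prepend_min q) n = 1%N.
Proof.
have q0 : q ord0 = ord0 by exact: etrans (ord1 _) (esym (ord1 _)).
apply/eqP; rewrite eqn_leq num_avoiders_gt0 ?prepend_min0 // andbT.
apply: leq_trans (num_avoiders_prepend_min_le _ q0) _.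
rewrite big_ord_recr /= subnn binn exp1n mul1n big1 => [|i _]; last first.
  by rewrite -(@ltn_predK 0 (n - i)) ?subn_gt0 // num_avoiders_length1 muln0.
by rewrite add0n; apply: leq_trans (max_card _) _; rewrite card_Sn.
Qed.

Theorem theorem5p4 (R : realType) (k : nat) (q : 'S_k.+1)
    (hq : q ord0 = ord0) :
  growth_limit R (prepend_min q) =
    1 + growth_limit R q + 2 * Num.sqrt (growth_limit R q).
Proof.
(* In length one [num_avoiders q] vanishes from [n = 1] on, so [root_limit_relation], which needs
   positive terms, does not apply; the limits are 0 and 1. *)
case: k q hq => [|k] q hq.
  have -> : growth_limit R q = 0.
    apply: cvg_growth_limit; apply: cvg_near_cst.
    exists 1%N => // -[//|n] _.
    by rewrite num_avoiders_length1 powR0 // invr_eq0 pnatr_eq0.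
  rewrite sqrtr0 mulr0 !addr0; apply: cvg_growth_limit; apply: cvg_near_cst.
  by exists 0%N => // n _; rewrite num_avoiders_prepend_min_length1 powR1.
have [C aC] := num_avoiders_exp_bound hq.
have q'0 := prepend_min0 q.
have [n|m n|n|n|m n|n|c m s|L [_ aL bL]] := @root_limit_relation R
    (num_avoiders q) (num_avoiders (prepend_min q)) C.
- exact: num_avoiders_gt0.
- exact: num_avoiders_supermul.
- exact: aC.
- exact: num_avoiders_gt0.
- exact: num_avoiders_supermul.
- exact: num_avoiders_prepend_min_le.
- exact: num_avoiders_prepend_min_ge.
by rewrite (cvg_growth_limit aL) (cvg_growth_limit bL).
Qed.
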